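(* Let $\mathbb{G}$ be the Gurariĭ space, let $\mathbf{\Omega}\colon\mathbb{G}\to\mathbb{G}$ be a non-expansive linear operator with the Gurariĭ property, and let $\mathbf{P}_{\mathbb{G}}\colon V_{\mathbb{G}}\to\mathbb{G}$ be a non-expansive linear operator with the left-Gurariĭ property (with respect to $\mathbb{S}=\mathbb{G}$), where $V_{\mathbb{G}}$ is a separable Banach space. Then $\mathbf{\Omega}$ and $\mathbf{P}_{\mathbb{G}}$ are equal up to linear isometries, i.e. there are bijective linear isometries $j\colon V_{\mathbb{G}}\to\mathbb{G}$ and $i\colon\mathbb{G}\to\mathbb{G}$ such that $\mathbf{\Omega}\circ j=i\circ\mathbf{P}_{\mathbb{G}}$.
   Context: All spaces are over a fixed scalar field ($\mathbb{R}$ or $\mathbb{C}$). An operator is non-expansive if its norm is at most $1$. For $\varepsilon>0$, an $\varepsilon$-embedding is a linear operator $f$ satisfying $(1-\varepsilon)\|x\|\le\|f(x)\|\le(1+\varepsilon)\|x\|$ for every $x$ in its domain. The Gurariĭ space $\mathbb{G}$ is the unique (up to linear isometry) separable Banach space such that for every $\varepsilon>0$, all finite-dimensional normed spaces $X_0\subseteq X$, and every linear isometric embedding $f_0\colon X_0\to\mathbb{G}$ there exists an $\varepsilon$-embedding $f\colon X\to\mathbb{G}$ with $f\restriction X_0=f_0$. Gurariĭ property of an operator $\mathbf{\Omega}\colon\mathbb{G}\to\mathbb{G}$: given $\varepsilon>0$, a non-expansive operator $T\colon X\to Y$ between finite-dimensional normed spaces, subspaces $X_0\subseteq X$, $Y_0\subseteq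 Y$ (with $T[X_0]\subseteq Y_0$) and linear isometric embeddings $i\colon X_0\to\mathbb{G}$, $j\colon Y_0\to\mathbb{G}$ such that $\mathbf{\Omega}\circ i=j\circ(T\restriction X_0)$, there exist $\varepsilon$-embeddings $i'\colon X\to\mathbb{G}$, $j'\colon Y\to\mathbb{G}$ satisfying $\|i'\restriction X_0-i\|\le\varepsilon$, $\|j'\restriction Y_0-j\|\le\varepsilon$ and $\|\mathbf{\Omega}\circ i'-j'\circ T\|\le\varepsilon$. A non-expansive operator on $\mathbb{G}$ with this property is known to exist and to be unique up to linear isometries. Left-Gurariĭ property with respect to a separable Banach space $\mathbb{S}$: a linear operator $P\colon V\to\mathbb{S}$ has it if for all finite-dimensional normed spaces $X_0\subseteq X$, every non-expansive linear operator $T\colon X\to\mathbb{S}$, every linear isometric embedding $e\colon X_0\to V$ such that $P\circ e=T\restriction X_0$, and every $\varepsilon>0$, there exists an $\varepsilon$-embedding $f\colon X\to V$ satisfying $\|f\restriction X_0-e\|\le\varepsilon$ and $\|P\circ f-T\|\le\varepsilon$. A non-expansive operator with this property and with separable Banach domain $V_{\mathbb{S}}$ is known to exist for each separable $\mathbb{S}$ and is denoted $\mathbf{P}_{\mathbb{S}}$. *)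

(* Defs.v *)
From HB Require Import structures.
From mathcomp Require Import all_boot all_order all_algebra complex.
From mathcomp Require Import all_classical all_reals all_analysis.

Set Implicit Arguments.
Unset Strict Implicit.
Unset Printing Implicit Defensive.

Import Order.TTheory GRing.Theory Num.Theory.
Import numFieldNormedType.Exports.

Local Open Scope classical_set_scope.
Local Open Scope ring_scope.

Variant scalar_kind := RealScalars | ComplexScalars.

Definition scalar_field (R : realType) (k : scalar_kind) : numFieldType :=
  match k with
  | RealScalars => R
  | ComplexScalars => R[i]%C
  end.

(* Norms on a [normedModType K] take their values in K.  When K is R[i], the
   order of K satisfies [0 < c] iff c is a positive real, so that [0 < eps]
   with [eps : K] quantifies over the positive real numbers in both cases. *)

#[short(type="finDimNormedType")]
HB.structure Definition FinDimNormed (K : numFieldType) :=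
  {X of Vector K X & NormedModule K X}.

(* A subspace [X0 : {vspace X}], seen as the type [subvs_of X0], carries the
   norm of X. *)
Section SubspaceNorm.
Variables (K : numFieldType) (X : finDimNormedType K) (X0 : {vspace X}).

Definition subvs_norm (x : subvs_of X0) : K := `|vsval x|.

Fact ler_subvs_normD (x y : subvs_of X0) :
  subvs_norm (x + y) <= subvs_norm x + subvs_norm y.
Proof. exact: ler_normD. Qed.

Fact subvs_normZ (a : K) (x : subvs_of X0) :
  subvs_norm (a *: x) = `|a| * subvs_norm x.
Proof. by rewrite /subvs_norm linearZ normrZ. Qed.

Fact subvs_norm0_eq0 (x : subvs_of X0) : subvs_norm x = 0 -> x = 0.
Proof. by move/normr0_eq0 => x0; apply: val_inj; rewrite /= x0. Qed.

HB.instance Definition _ := Lmodule_isNormed.Build K (subvs_of X0)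
  ler_subvs_normD subvs_normZ subvs_norm0_eq0.

End SubspaceNorm.

Section Operators.
Variables (K : numFieldType) (V W : normedModType K).

(* The operator norm of f is at most c. *)
Definition opnorm_le (f : V -> W) (c : K) := forall x, `|f x| <= c * `|x|.

Definition nonexpansive (f : V -> W) := opnorm_le f 1.

Definition isometric (f : V -> W) := forall x, `|f x| = `|x|.

Definition eps_embedding (eps : K) (f : {linear V -> W}) :=
  forall x, (1 - eps) * `|x| <= `|f x| <= (1 + eps) * `|x|.

End Operators.

Definition separable_space (T : topologicalType) :=
  exists2 D : set T, countable D & dense D.

Definition gurarii_space (K : numFieldType) (G : completeNormedModType K) :=
  separable_space G /\
  forall (eps : K) (X : finDimNormedType K) (X0 : {vspace X})
         (f0 : {linear subvs_of X0 -> G}),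
    0 < eps -> isometric f0 ->
    exists2 f : {linear X -> G}, eps_embedding eps f & f \o vsval =1 f0.

(* Since T maps X0 into Y0, the map [vsproj Y0 \o T \o vsval] is the
   restriction of T to a map from X0 to Y0. *)
Definition gurarii_operator (K : numFieldType) (G : normedModType K)
    (Omega : {linear G -> G}) :=
  forall (eps : K) (X Y : finDimNormedType K) (T : {linear X -> Y})
         (X0 : {vspace X}) (Y0 : {vspace Y})
         (i : {linear subvs_of X0 -> G}) (j : {linear subvs_of Y0 -> G}),
    0 < eps -> nonexpansive T ->
    (forall x, x \in X0 -> T x \in Y0) ->
    isometric i -> isometric j ->
    Omega \o i =1 j \o vsproj Y0 \o T \o vsval ->
    exists (i' : {linear X -> G}) (j' : {linear Y -> G}),
      [/\ eps_embedding eps i' /\ eps_embedding eps j',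
          opnorm_le ((i' \o vsval) \- i) eps,
          opnorm_le ((j' \o vsval) \- j) eps &
          opnorm_le ((Omega \o i') \- (j' \o T)) eps].

Definition left_gurarii_operator (K : numFieldType) (V S : normedModType K)
    (P : {linear V -> S}) :=
  forall (X : finDimNormedType K) (X0 : {vspace X}) (T : {linear X -> S})
         (e : {linear subvs_of X0 -> V}) (eps : K),
    nonexpansive T -> isometric e -> P \o e =1 T \o vsval -> 0 < eps ->
    exists f : {linear X -> V},
      [/\ eps_embedding eps f,
          opnorm_le ((f \o vsval) \- e) eps &
          opnorm_le ((P \o f) \- T) eps].

(* Main.v *)
Require Import Defs.
From HB Require Import structures.
From mathcomp Require Import all_boot all_order all_algebra complex.
From mathcomp Require Import all_classical all_reals all_analysis.
From mathcomp Require Import ring lra.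

(** Both operators have the same extension property for operators between
    finite-dimensional spaces, and a back-and-forth argument shows that two
    operators with that property, between separable Banach spaces, agree up to
    linear isometries.

    The extension property of [P : V -> W] ([extension_property]) says the
    following. Let [T] and [T'] be non-expansive operators, from [X] to [Y] and
    from [X'] to [Y'], between finite-dimensional spaces. Suppose that [T] sits
    isometrically inside [P], and let [f : X -> X'] and [g : Y -> Y'] be
    e-embeddings that intertwine [T] and [T'] up to e. Then [T'] embeds into
    [P], with an error as small as desired, so that the composite with [(f, g)]
    is within 10 e of the given copy of [T]. The tool is an amalgam
    ([amalgam]): the space [X * X'] has a norm that extends those of [X] and
    [X'] and makes [x] and [f x] close, and two operators defined on [X] and
    [X'] that nearly agree along [f] glue to a non-expansive operator. Thus
    [T] and [T'] glue to one operator that contains [T] isometrically.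
    - For [Omega], the Gurarii property applies to the glued operator
      ([extension_of_gurarii]).
    - For [P] with values in the Gurarii space, the codomain is extended first,
      by the defining property of that space, and the domain next, by the
      left-Gurarii property ([extension_of_left_gurarii]). The extension of the
      codomain is only an embedding up to t, so the operator obtained on [X'] is
      only bounded by 1 + t; this is why the amalgam may multiply the norm of
      [X'] by a factor [l].

    For the back-and-forth ([extension_property_unique]), a partial isomorphism
    is recorded by its graphs [A] in [V * V'] and [B] in [W * W'], which are
    images of finite-dimensional spaces. Applying the extension property to one
    operator and then to the other moves [A] and [B] by little and brings given
    vectors into their projections ([partial_iso_step]). The lower limits of the
    sequences of graphs are closed linear relations that preserve the norm and
    have dense projections, hence graphs of bijective isometries
    ([liminf_graph]).

    The scalar field is either [R] or the complex numbers; a [real_scale]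
    gives access to real-valued norms in both cases. *)

Set Implicit Arguments.
Unset Strict Implicit.
Unset Printing Implicit Defensive.

Import Order.TTheory GRing.Theory Num.Theory.
Import numFieldNormedType.Exports.

Local Open Scope classical_set_scope.
Local Open Scope ring_scope.

(** * Real-valued norms *)

(** A copy of the reals [R] inside the scalars [K] that contains all
    nonnegative scalars. Only the value of [real_part] on nonnegative scalars
    matters. *)
Record real_scale (R : realType) (K : numFieldType) := RealScale {
  emb :> {rmorphism R -> K};
  emb_le : {mono emb : x y / x <= y};
  real_part : K -> R;
  real_partK : forall x, 0 <= x -> emb (real_part x) = x
}.

Lemma linear_fun_exists (K : numFieldType) (U V : lmodType K) (f : U -> V) :
  linear f -> exists g : {linear U -> V}, g =1 f.
Proof.
move=> lf.
pose m := GRing.isLinear.Build K U V *:%R f lf.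
pose g : {linear U -> V} := HB.pack f m.
by exists g.
Qed.

Section RealNorm.
Variables (R : realType) (K : numFieldType) (S : real_scale R K).

Lemma emb_lt : {mono S : x y / x < y}.
Proof. exact: (leW_mono (emb_le S)). Qed.

Lemma emb_inj : injective S.
Proof. exact: (inc_inj (emb_le S)). Qed.

Lemma emb_gt0 (e : K) : 0 < e -> exists2 r : R, 0 < r & e = S r.
Proof.
move=> e0; exists (real_part S e); last by rewrite real_partK // ltW.
by rewrite -emb_lt rmorph0 real_partK // ltW.
Qed.

(** The norm, as an element of [R] instead of [K]. *)
Definition nrm (V : normedModType K) (x : V) : R := real_part S `|x|.

Lemma nrmE (V : normedModType K) (x : V) : `|x| = S (nrm x).
Proof. by rewrite real_partK. Qed.

Lemma nrm_ge0 (V : normedModType K) (x : V) : 0 <= nrm x.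
Proof. by rewrite -(emb_le S) -nrmE rmorph0. Qed.

Lemma nrmD (V : normedModType K) (x y : V) : nrm (x + y) <= nrm x + nrm y.
Proof. by rewrite -(emb_le S) rmorphD -!nrmE ler_normD. Qed.

Lemma nrmZ (V : normedModType K) a (x : V) :
  nrm (a *: x) = real_part S `|a| * nrm x.
Proof. by apply: emb_inj; rewrite rmorphM real_partK // -!nrmE normrZ. Qed.

Lemma nrm0 (V : normedModType K) : nrm (0 : V) = 0.
Proof. by apply: emb_inj; rewrite -nrmE normr0 rmorph0. Qed.

Lemma nrmN (V : normedModType K) (x : V) : nrm (- x) = nrm x.
Proof. by rewrite /nrm normrN. Qed.

Lemma nrmBC (V : normedModType K) (x y : V) : nrm (x - y) = nrm (y - x).
Proof. by rewrite -nrmN opprB. Qed.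

Lemma nrmB (V : normedModType K) (x y : V) : nrm (x - y) <= nrm x + nrm y.
Proof. by rewrite -(nrmN y) nrmD. Qed.

Lemma nrm_dist (V : normedModType K) (x y z : V) :
  nrm (x - z) <= nrm (x - y) + nrm (y - z).
Proof. by have := nrmD (x - y) (y - z); rewrite addrA subrK. Qed.

Lemma nrm_le_dist (V : normedModType K) (x y : V) :
  nrm x <= nrm y + nrm (x - y).
Proof. by have := nrmD y (x - y); rewrite addrC subrK. Qed.

Lemma nrm0_eq0 (V : normedModType K) (x : V) : nrm x = 0 -> x = 0.
Proof. by move=> x0; apply/normr0_eq0; rewrite nrmE x0 rmorph0. Qed.

Lemma nrm_le0_eq0 (V : normedModType K) (x : V) : nrm x <= 0 -> x = 0.
Proof.
by move=> x0; apply: nrm0_eq0; apply/le_anti; rewrite x0 nrm_ge0.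
Qed.

Section Operators.
Variables (V W : normedModType K).

Lemma opnorm_leE (f : V -> W) c :
  opnorm_le f (S c) <-> forall x, nrm (f x) <= c * nrm x.
Proof.
by split=> h x; have := h x; rewrite !nrmE -rmorphM (emb_le S).
Qed.

Lemma nonexpansiveE (f : V -> W) :
  nonexpansive f <-> forall x, nrm (f x) <= nrm x.
Proof.
rewrite /nonexpansive -(rmorph1 S) opnorm_leE.
by split=> h x; have := h x; rewrite mul1r.
Qed.

Lemma isometricE (f : V -> W) : isometric f <-> forall x, nrm (f x) = nrm x.
Proof.
split=> h x; first by rewrite /nrm h.
by rewrite !nrmE h.
Qed.

Lemma eps_embeddingE c (f : {linear V -> W}) : eps_embedding (S c) f <->
  forall x, (1 - c) * nrm x <= nrm (f x) /\ nrm (f x) <= (1 + c) * nrm x.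
Proof.
have E x : ((1 - S c) * `|x| <= `|f x| <= (1 + S c) * `|x|) =
    ((1 - c) * nrm x <= nrm (f x)) && (nrm (f x) <= (1 + c) * nrm x).
  by rewrite !nrmE -[1](rmorph1 S) -rmorphB -rmorphD -!rmorphM !(emb_le S).
split=> h x.
  by have := h x; rewrite E => /andP.
by rewrite E; apply/andP.
Qed.

Lemma isometric_inj (f : {linear V -> W}) : isometric f -> injective f.
Proof.
move/isometricE => h x y fxy; apply/subr0_eq/nrm0_eq0.
by rewrite -h linearB fxy subrr nrm0.
Qed.

End Operators.

End RealNorm.

(** The vector space [X], as a type of its own that carries the norm [N]; the
    product of two normed spaces already has another norm, which the alias
    hides. *)
Definition renormed (R : realType) (K : numFieldType) (S : real_scale R K)
  (X : vectType K) (N : X -> R) (ND : forall x y, N (x + y) <= N x + N y)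
  (NZ : forall a x, N (a *: x) = real_part S `|a| * N x)
  (N0 : forall x, N x = 0 -> x = 0) : Type := X.

Section Renormed.
Variables (R : realType) (K : numFieldType) (S : real_scale R K).
Variables (X : vectType K) (N : X -> R).
Hypotheses (ND : forall x y, N (x + y) <= N x + N y)
  (NZ : forall a x, N (a *: x) = real_part S `|a| * N x)
  (N0 : forall x, N x = 0 -> x = 0).

Local Notation Z := (renormed ND NZ N0).
HB.instance Definition _ := Vector.on Z.

Let NK (x : Z) : K := S (N x).
Fact renormedD (x y : Z) : NK (x + y) <= NK x + NK y.
Proof. by rewrite /NK -rmorphD (emb_le S) ND. Qed.
Fact renormedZ a (x : Z) : NK (a *: x) = `|a| * NK x.
Proof. by rewrite /NK NZ rmorphM real_partK. Qed.
Fact renormed0 (x : Z) : NK x = 0 -> x = 0.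
Proof. by move=> x0; apply/N0/(@emb_inj _ _ S); rewrite rmorph0. Qed.

HB.instance Definition _ := Lmodule_isNormed.Build K Z
  renormedD renormedZ renormed0.

End Renormed.

Lemma renorm_exists (R : realType) (K : numFieldType) (S : real_scale R K)
    (X : vectType K) (N : X -> R) :
    (forall x y, N (x + y) <= N x + N y) ->
    (forall a x, N (a *: x) = real_part S `|a| * N x) ->
    (forall x, N x = 0 -> x = 0) ->
  exists (Z : finDimNormedType K) (t : {linear X -> Z}) (t' : {linear Z -> X}),
    [/\ cancel t t', cancel t' t & forall x, nrm S (t x) = N x].
Proof.
move=> ND NZ N0.
pose Z : finDimNormedType K := renormed ND NZ N0.
have [t tE] : exists t : {linear X -> Z}, t =1 (id : X -> Z).
  by apply: linear_fun_exists => a x y.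
have [t' t'E] : exists t' : {linear Z -> X}, t' =1 (id : Z -> X).
  by apply: linear_fun_exists => a x y.
exists Z, t, t'; split=> x; rewrite ?tE ?t'E //.
by apply: (@emb_inj _ _ S); rewrite -nrmE.
Qed.

(** * Finite-dimensional normed spaces and amalgams *)

(** A subspace of maximal dimension among those on which [h] is injective has
    the same image under [h] as the whole space. *)
Lemma max_injective_subspace (K : fieldType) (Z : vectType K) (V : lmodType K)
    (h : {linear Z -> V}) :
  exists A : {vspace Z}, (forall x, x \in A -> h x = 0 -> x = 0) /\
    forall z, exists2 x, x \in A & h x = h z.
Proof.
pose inj (A : {vspace Z}) := forall x, x \in A -> h x = 0 -> x = 0.
pose p := [pred n : nat | `[< exists2 A, inj A & \dim A = n >]].
have p0 : exists n, p n.
  exists 0%N; apply/asboolP; exists 0%VS; last by rewrite dimv0.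
  by move=> x; rewrite memv0 => /eqP.
have pb n : p n -> (n <= \dim {:Z})%N.
  by move=> /asboolP[A _ <-]; apply/dimvS/subvf.
case: (ex_maxnP p0 pb) => n /asboolP[A injA dA] maxn.
exists A; split=> // z; apply: contrapT => nz.
pose B := (A + <[z]>)%VS.
have injB : inj B.
  move=> x /memv_addP[u uA [_ /vlineP[c ->] ->]].
  have [->|c0] := eqVneq c 0.
    by rewrite scale0r addr0; exact: injA.
  rewrite linearD linearZ /= => /eqP; rewrite addr_eq0 => /eqP huz.
  case: nz; exists (- (c^-1 *: u)); first by rewrite rpredN rpredZ.
  by rewrite linearN linearZ /= huz scalerN opprK scalerA mulVf // scale1r.
have /maxn dB : p (\dim B) by apply/asboolP; exists B.
have : A == B by rewrite eqEdim addvSl dA.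
move/eqP => AB; apply: nz; exists z => //.
by rewrite AB (subvP (addvSr _ _)) // memv_line.
Qed.

Section FinDim.
Variables (R : realType) (K : numFieldType) (S : real_scale R K).
Local Notation nrm := (nrm S).

(** The image of a linear map from a finite-dimensional space, as an abstract
    finite-dimensional space [X] with an isometric embedding [a] into [V]. *)
Lemma image_fin_dim (Z : vectType K) (V : normedModType K)
    (h : {linear Z -> V}) :
  exists (X : finDimNormedType K) (a : {linear X -> V}) (s : {linear Z -> X}),
    isometric a /\ forall z, a (s z) = h z.
Proof.
have [A [injA surA]] := max_injective_subspace h.
have [] := @renorm_exists R K S (subvs_of A) (fun x => nrm (h (vsval x))).
- by move=> x y; rewrite !linearD nrmD.
- by move=> c x; rewrite !linearZ nrmZ.
- by move=> x /nrm0_eq0 hx; apply/val_inj/injA => //; apply: subvsP.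
move=> X [t [t' [tK t'K tN]]].
have aN : isometric (h \o vsval \o t' : {linear X -> V}).
  by apply/(isometricE S) => x /=; rewrite -tN t'K.
have /choice[f fP] : forall z, exists x, x \in A /\ h x = h z.
  by move=> z; have [x] := surA z; exists x.
have [s sE] : exists s : {linear Z -> X}, s =1 t \o vsproj A \o f.
  apply: linear_fun_exists => c x y /=.
  rewrite -linearP -linearP /=; congr (t (vsproj _ _)).
  have [/= fA hf] := fP (c *: x + y).
  have [/= fxA hx] := fP x; have [/= fyA hy] := fP y.
  apply/subr0_eq/injA; first by rewrite rpredB // rpredD // rpredZ.
  have e : h (c *: x + y) = h (c *: f x + f y) by rewrite !linearP hx hy.
  by rewrite linearB hf e subrr.
exists X, (h \o vsval \o t' : {linear X -> V}), s; split=> // z /=.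
by rewrite sE /= tK vsprojK ?(fP z).1 // (fP z).2.
Qed.

(** An isometric copy [u] of [X] in [Z] turns an isometry on [X] into an
    isometry on a subspace of [Z]. *)
Lemma isometric_range (X Z : finDimNormedType K) (V : normedModType K)
    (u : {linear X -> Z}) (a : {linear X -> V}) :
    isometric u -> isometric a ->
  exists (X0 : {vspace Z}) (i : {linear subvs_of X0 -> V}),
    [/\ isometric i, forall x, u x \in X0,
      forall x, i (vsproj X0 (u x)) = a x &
      forall x0 : subvs_of X0, exists x, vsval x0 = u x].
Proof.
move=> uN aN; pose X0 := limg (linfun u).
have uX0 x : u x \in X0 by rewrite -(lfunE u) memv_img ?memvf.
have /choice[f fP] : forall x0 : subvs_of X0, exists x, u x = vsval x0.
  move=> x0.
  have /memv_imgP[x _ xE] := subvsP x0.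
  by exists x; rewrite xE lfunE.
have [i iE] : exists i : {linear subvs_of X0 -> V}, i =1 a \o f.
  apply: linear_fun_exists => c x y /=; rewrite -linearP; congr (a _).
  by apply: (isometric_inj S uN); rewrite linearP !fP linearP.
exists X0, i; split=> // x; last by exists (f x); rewrite fP.
  by rewrite iE /= aN -uN fP.
rewrite iE /=; congr (a _); apply: (isometric_inj S uN).
by rewrite fP vsprojK.
Qed.

Lemma real_part_norm1 : real_part S `|1 : K| = 1.
Proof. by apply: (@emb_inj _ _ S); rewrite real_partK // normr1 rmorph1. Qed.

Lemma real_part_normM (a b : K) :
  real_part S `|a * b| = real_part S `|a| * real_part S `|b|.
Proof. by apply: (@emb_inj _ _ S); rewrite rmorphM !real_partK // normrM. Qed.

Lemma real_part_norm_ge0 (a : K) : 0 <= real_part S `|a|.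
Proof. by rewrite -(emb_le S) real_partK // rmorph0. Qed.

Section Amalgam.
Variables (X X' : finDimNormedType K) (f : {linear X -> X'}) (l c : R).
Hypotheses (l0 : 0 < l) (c0 : 0 < c).
Hypothesis lf : forall x, nrm x <= l * nrm (f x) + c * nrm x.
Hypothesis fl : forall x, l * nrm (f x) <= (1 + c) * nrm x.

(** The cost of the decomposition [p = (p.1 - w, p.2 + f w) + (w, - f w)], where
    [(w, - f w)] is charged [c * nrm w]. *)
Definition amalgam_cost (p : X * X') (w : X) : R :=
  nrm (p.1 - w) + l * nrm (p.2 + f w) + c * nrm w.

(** The infimum of the costs of [p]. *)
Definition amalgam_norm (p : X * X') : R := inf (range (amalgam_cost p)).

Lemma amalgam_cost_ge0 p w : 0 <= amalgam_cost p w.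
Proof.
by rewrite /amalgam_cost !addr_ge0 ?nrm_ge0 // mulr_ge0 ?nrm_ge0 // ltW.
Qed.

Lemma amalgam_norm_le p w : amalgam_norm p <= amalgam_cost p w.
Proof.
apply: ge_inf; last by exists w.
by exists 0 => _ [v _ <-]; exact: amalgam_cost_ge0.
Qed.

Lemma le_amalgam_norm p b :
  (forall w, b <= amalgam_cost p w) -> b <= amalgam_norm p.
Proof.
move=> h; apply: lb_le_inf; first by exists (amalgam_cost p 0), 0.
by move=> _ [w _ <-].
Qed.

Lemma amalgam_normD p q :
  amalgam_norm (p + q) <= amalgam_norm p + amalgam_norm q.
Proof.
rewrite -lerBlDl; apply: le_amalgam_norm => v.
rewrite lerBlDr -lerBlDl; apply: le_amalgam_norm => w; rewrite lerBlDl.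
apply: le_trans (amalgam_norm_le _ (v + w)) _; rewrite /amalgam_cost /=.
have h1 := nrmD S (q.1 - v) (p.1 - w).
have h2 := nrmD S (q.2 + f v) (p.2 + f w); have h3 := nrmD S v w.
have -> : p.1 + q.1 - (v + w) = (q.1 - v) + (p.1 - w).
  by rewrite opprD (addrC p.1) addrACA.
have -> : p.2 + q.2 + f (v + w) = (q.2 + f v) + (p.2 + f w).
  by rewrite linearD (addrC p.2) addrACA.
move: (ler_wpM2l (ltW l0) h2) (ler_wpM2l (ltW c0) h3); lra.
Qed.

Lemma amalgam_normZ_le a p :
  amalgam_norm (a *: p) <= real_part S `|a| * amalgam_norm p.
Proof.
have a_ge0 := real_part_norm_ge0 a.
have key w : amalgam_norm (a *: p) <= real_part S `|a| * amalgam_cost p w.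
  apply: le_trans (amalgam_norm_le _ (a *: w)) _; rewrite /amalgam_cost /=.
  have -> : f (a *: w) = a *: f w by rewrite linearZ.
  by rewrite -scalerBr -scalerDr !nrmZ !mulrDr !(mulrCA l)
    !(mulrCA c).
have [a0|] := ltP 0 (real_part S `|a|).
  rewrite mulrC -ler_pdivrMr //; apply: le_amalgam_norm => w.
  by rewrite ler_pdivrMr // mulrC.
move=> a0; have {a0}a0 : real_part S `|a| = 0 by apply/le_anti; rewrite a0.
by have := key 0; rewrite a0 !mul0r.
Qed.

Lemma amalgam_normZ a p :
  amalgam_norm (a *: p) = real_part S `|a| * amalgam_norm p.
Proof.
apply/le_anti; rewrite amalgam_normZ_le /=.
have [->|a0] := eqVneq a 0.
  have -> : real_part S `|0 : K| = 0.
    by apply: (@emb_inj _ _ S); rewrite real_partK // normr0 rmorph0.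
  rewrite mul0r; apply: le_amalgam_norm => w; exact: amalgam_cost_ge0.
have := ler_wpM2l (real_part_norm_ge0 a) (amalgam_normZ_le a^-1 (a *: p)).
by rewrite scalerA mulVf // scale1r mulrA -real_part_normM divff //
  real_part_norm1 mul1r.
Qed.

Lemma amalgam_norm_inl x : amalgam_norm (x, 0) = nrm x.
Proof.
apply/le_anti/andP; split.
  apply: le_trans (amalgam_norm_le _ 0) _; rewrite /amalgam_cost /=.
  by rewrite subr0 linear0 addr0 !nrm0 !mulr0 !addr0.
apply: le_amalgam_norm => w; rewrite /amalgam_cost /= add0r.
by have := nrm_le_dist S x w; have := lf w; lra.
Qed.

Lemma amalgam_norm_inr y : amalgam_norm (0, y) = l * nrm y.
Proof.
apply/le_anti/andP; split.
  apply: le_trans (amalgam_norm_le _ 0) _; rewrite /amalgam_cost /=.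
  by rewrite subr0 linear0 addr0 !nrm0 !mulr0 !addr0 add0r.
apply: le_amalgam_norm => w; rewrite /amalgam_cost /= sub0r nrmN.
have := nrmB S (y + f w) (f w); rewrite addrK => /(ler_wpM2l (ltW l0)).
by have := fl w; lra.
Qed.

Lemma amalgam_norm0_eq0 p : amalgam_norm p = 0 -> p = 0.
Proof.
case: p => x y Np.
have x0 : x = 0.
  apply: (@nrm_le0_eq0 _ _ S).
  (* every decomposition costs at least [Num.min 1 c * nrm x] *)
  have m0 : 0 < Num.min 1 c by rewrite lt_min ltr01.
  rewrite -(pmulr_rle0 _ m0) -Np; apply: le_amalgam_norm => w.
  have h1 : Num.min 1 c * nrm (x - w) <= nrm (x - w).
    by rewrite ler_piMl ?nrm_ge0 // ge_min lexx.
  have h2 : Num.min 1 c * nrm w <= c * nrm w.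
    by rewrite ler_wpM2r ?nrm_ge0 // ge_min lexx orbT.
  have := ler_wpM2l (ltW m0) (nrm_le_dist S x w).
  rewrite /amalgam_cost /=.
  have := mulr_ge0 (ltW l0) (nrm_ge0 S (y + f w)); lra.
move: Np; rewrite {}x0 amalgam_norm_inr => /eqP; rewrite mulf_eq0 gt_eqF //=.
by move=> /eqP/nrm0_eq0 ->.
Qed.

(** [Z] contains [X] isometrically and [X'] with its norm multiplied by [l], the
    two copies are [c]-close along [f], and operators on [X] and [X'] that are
    compatible with these three bounds glue to a non-expansive operator. *)
Definition is_amalgam (Z : finDimNormedType K) (inl : {linear X -> Z})
    (inr : {linear X' -> Z}) :=
  [/\ isometric inl, forall y, nrm (inr y) = l * nrm y,
    forall x, nrm (inr (f x) - inl x) <= c * nrm x &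
    forall (W : normedModType K) (A : {linear X -> W}) (B : {linear X' -> W}),
      (forall x, nrm (A x) <= nrm x) -> (forall y, nrm (B y) <= l * nrm y) ->
      (forall x, nrm (A x - B (f x)) <= c * nrm x) ->
      exists T : {linear Z -> W}, [/\ forall z, nrm (T z) <= nrm z,
        forall x, T (inl x) = A x & forall y, T (inr y) = B y]].

Lemma amalgam : exists (Z : finDimNormedType K)
  (inl : {linear X -> Z}) (inr : {linear X' -> Z}), is_amalgam inl inr.
Proof.
have [Z [t [t' [tK t'K tN]]]] :=
  renorm_exists amalgam_normD amalgam_normZ amalgam_norm0_eq0.
have [inl inlE] : exists g : {linear X -> Z}, g =1 fun x => t (x, 0).
  apply: linear_fun_exists => a x y; rewrite -linearP; congr (t _).
  by apply: injective_projections => /=; rewrite ?scaler0 ?addr0.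
have [inr inrE] : exists g : {linear X' -> Z}, g =1 fun y => t (0, y).
  apply: linear_fun_exists => a x y; rewrite -linearP; congr (t _).
  by apply: injective_projections => /=; rewrite ?scaler0 ?addr0.
exists Z, inl, inr; split.
- by apply/(isometricE S) => x; rewrite inlE tN amalgam_norm_inl.
- by move=> y; rewrite inrE tN amalgam_norm_inr.
- move=> x; rewrite inlE inrE -linearB tN -opprB -scaleN1r amalgam_normZ.
  rewrite normrN real_part_norm1 mul1r.
  apply: le_trans (amalgam_norm_le _ x) _; rewrite /amalgam_cost /=.
  by rewrite subr0 sub0r addNr subrr !nrm0 mulr0 !add0r.
move=> W A B hA hB hAB.
have [T TE] : exists T : {linear Z -> W},
    T =1 fun z => A (t' z).1 + B (t' z).2.
  apply: linear_fun_exists => a x y.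
  have -> : t' (a *: x + y) = a *: t' x + t' y by rewrite linearP.
  have -> (u v : X) : A (a *: u + v) = a *: A u + A v by rewrite linearP.
  have -> (u v : X') : B (a *: u + v) = a *: B u + B v by rewrite linearP.
  by rewrite scalerDr addrACA.
exists T; split.
- move=> z; rewrite TE.
  have -> : nrm z = amalgam_norm (t' z) by rewrite -tN t'K.
  case: (t' z) => x y /=.
  apply: le_amalgam_norm => w; rewrite /amalgam_cost /=.
  have -> : A x + B y = A (x - w) + (B (y + f w) + (A w - B (f w))).
    rewrite linearB linearD (addrC (A w)) (addrA (B y + _)) addrK.
    by rewrite (addrC (B y)) addrA subrK.
  have := nrmD S (A (x - w)) (B (y + f w) + (A w - B (f w))).
  have := nrmD S (B (y + f w)) (A w - B (f w)).
  have := hA (x - w); have := hB (y + f w); have := hAB w; lra.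
- by move=> x; rewrite TE inlE tK /= linear0 addr0.
- by move=> x; rewrite TE inrE tK /= linear0 add0r.
Qed.

End Amalgam.
End FinDim.

(** * The extension property *)

Section Extension.
Variables (R : realType) (K : numFieldType) (S : real_scale R K).
Local Notation nrm := (nrm S).

(** The extension property described at the top: [T'] embeds into [P] with
    error [d], and the new embedding agrees along [(f, g)] with the isometric
    embedding [(a, b)] of [T], up to a multiple of the error [e] of [(f, g)]. *)
Definition extension_property (V W : normedModType K) (P : {linear V -> W}) :=
  forall (X Y X' Y' : finDimNormedType K)
    (T : {linear X -> Y}) (T' : {linear X' -> Y'})
    (a : {linear X -> V}) (b : {linear Y -> W})
    (f : {linear X -> X'}) (g : {linear Y -> Y'}) (e d : R),
    0 < e <= 1 -> 0 < d <= e ->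
    nonexpansive T -> nonexpansive T' -> isometric a -> isometric b ->
    (forall x, P (a x) = b (T x)) ->
    eps_embedding (S e) f -> eps_embedding (S e) g ->
    (forall x, nrm (T' (f x) - g (T x)) <= e * nrm x) ->
  exists (f' : {linear X' -> V}) (g' : {linear Y' -> W}),
    [/\ eps_embedding (S d) f', eps_embedding (S d) g',
      forall x, nrm (P (f' x) - g' (T' x)) <= d * nrm x,
      forall x, nrm (f' (f x) - a x) <= 10%:R * e * nrm x &
      forall y, nrm (g' (g y) - b y) <= 10%:R * e * nrm y].

Lemma amalgam_embedding (X X' : finDimNormedType K) (f : {linear X -> X'})
    (e l c : R) : 0 < e -> eps_embedding (S e) f -> 1 <= l -> e <= c ->
    l * (1 + e) <= 1 + c ->
  exists (Z : finDimNormedType K) (inl : {linear X -> Z})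
    (inr : {linear X' -> Z}), is_amalgam S f l c inl inr.
Proof.
move=> e0 /eps_embeddingE femb l1 ec lec; apply: amalgam.
- lra.
- lra.
- move=> x; have [h _] := femb x.
  have := ler_wpM2r (nrm_ge0 S x) ec; have := ler_wpM2r (nrm_ge0 S (f x)) l1.
  lra.
- move=> x; have [_ h] := femb x.
  have l0 : 0 <= l by lra.
  have := ler_wpM2r (nrm_ge0 S x) lec; have := ler_wpM2l l0 h.
  by rewrite mulrA; apply: le_trans.
Qed.

(** The domains are amalgamated with the parameter [4 * e], larger than the
    parameter [e] of the codomains, to pay for the failure of [(f, g)] to
    intertwine [T] and [T'] exactly. *)
Lemma extension_of_gurarii (G : normedModType K) (Omega : {linear G -> G}) :
  gurarii_operator Omega -> extension_property Omega.
Proof.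
move=> hOmega X Y X' Y' T T' a b f g e d /andP[e0 e1] /andP[d0 de].
move=> /(nonexpansiveE S) nT /(nonexpansiveE S) nT' aN bN PT femb gemb Tfg.
have [|U [inlU [inrU [inlUN inrUN UD Uext]]]] :=
  @amalgam_embedding _ _ g e 1 e e0 gemb (lexx 1) (lexx e).
  by rewrite mul1r.
have [|| Z [inlZ [inrZ [inlZN inrZN ZD Zext]]]] :=
  @amalgam_embedding _ _ f e 1 (4%:R * e) e0 femb (lexx 1); [lra|lra|].
have := inlUN; move/(isometricE S) => inlUN'.
have := inlZN; move/(isometricE S) => inlZN'.
have [|||TZ [nTZ TZl TZr]] := Zext U (inlU \o T) (inrU \o T').
- by move=> x /=; rewrite inlUN'.
- by move=> y /=; rewrite inrUN !mul1r.
- move=> x /=; have h1 := UD (T x); have h2 := Tfg x.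
  have := nrm_dist S (inlU (T x)) (inrU (g (T x))) (inrU (T' (f x))).
  rewrite -[in X in _ <= _ + X]linearB inrUN mul1r [nrm (g _ - _)]nrmBC.
  rewrite [nrm (inlU _ - inrU (g _))]nrmBC.
  have := ler_wpM2l (ltW e0) (nT x).
  have := mulr_ge0 (ltW e0) (nrm_ge0 S x); lra.
have [X0 [i [iN X0P iP X0E]]] := isometric_range S inlZN aN.
have [Y0 [j [jN Y0P jP Y0E]]] := isometric_range S inlUN bN.
have := hOmega (S d) Z U TZ X0 Y0 i j.
case => //.
- by rewrite -(rmorph0 S) (emb_lt S).
- by apply/(nonexpansiveE S).
- move=> x xX0; have [x1] := X0E (vsproj X0 x).
  by rewrite vsprojK // => ->; rewrite TZl /= Y0P.
- move=> x0; have [x1 xE] := X0E x0.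
  by rewrite /= -{1}(vsvalK x0) xE iP TZl /= jP.
move=> i' [j' [[i'e j'e] /(opnorm_leE S) i'i /(opnorm_leE S) j'j]].
move=> /(opnorm_leE S) TT.
move/(eps_embeddingE S): i'e => i'e; move/(eps_embeddingE S): j'e => j'e.
have d1 : 1 + d <= 2%:R by lra.
exists (i' \o inrZ), (j' \o inrU); split.
- apply/(eps_embeddingE S) => x /=; have := i'e (inrZ x).
  by rewrite inrZN mul1r.
- apply/(eps_embeddingE S) => x /=; have := j'e (inrU x).
  by rewrite inrUN mul1r.
- by move=> x /=; have := TT (inrZ x); rewrite /= TZr inrZN mul1r.
- move=> x /=.
  have := i'i (vsproj X0 (inlZ x)); rewrite /= vsprojK // iP.
  have -> : nrm (vsproj X0 (inlZ x)) = nrm x.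
    by rewrite -inlZN' -[in RHS](vsprojK (X0P x)).
  have := (i'e (inrZ (f x) - inlZ x)).2; rewrite linearB.
  have := nrm_dist S (i' (inrZ (f x))) (i' (inlZ x)) (a x).
  have := ler_wpM2r (nrm_ge0 S (inrZ (f x) - inlZ x)) d1.
  have := mulr_ge0 (ltW e0) (nrm_ge0 S x).
  have := ZD x; have := ler_wpM2r (nrm_ge0 S x) de; lra.
- move=> x /=.
  have := j'j (vsproj Y0 (inlU x)); rewrite /= vsprojK // jP.
  have -> : nrm (vsproj Y0 (inlU x)) = nrm x.
    by rewrite -inlUN' -[in RHS](vsprojK (Y0P x)).
  have := (j'e (inrU (g x) - inlU x)).2; rewrite linearB.
  have := nrm_dist S (j' (inrU (g x))) (j' (inlU x)) (b x).
  have := ler_wpM2r (nrm_ge0 S (inrU (g x) - inlU x)) d1.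
  have := mulr_ge0 (ltW e0) (nrm_ge0 S x).
  have := UD x; have := ler_wpM2r (nrm_ge0 S x) de; lra.
Qed.

(** The error [d] is split in three: the codomain is embedded first with error
    [t = d / 3], and the domain next, with error [t] in a space where the norm
    of [X'] is multiplied by [1 + t]. *)
Lemma extension_of_left_gurarii (V : normedModType K)
    (G : completeNormedModType K) (P : {linear V -> G}) :
  gurarii_space G -> nonexpansive P -> left_gurarii_operator P ->
  extension_property P.
Proof.
move=> [_ hG] /(nonexpansiveE S) nP hP.
move=> X Y X' Y' T T' a b f g e d /andP[e0 e1] /andP[d0 de].
move=> /(nonexpansiveE S) nT /(nonexpansiveE S) nT' aN bN PT femb gemb Tfg.
pose t := d / 3%:R.
have t0 : 0 < t by rewrite /t; lra.
have td : 3%:R * t = d by rewrite /t; lra.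
have St0 : 0 < S t by rewrite -(rmorph0 S) (emb_lt S).
have tt : t * t <= t by rewrite ger_pMl //; lra.
have te : t * e <= e by rewrite ger_pMl //; lra.
have [|U [inlU [inrU [inlUN inrUN UD Uext]]]] :=
  @amalgam_embedding _ _ g e 1 e e0 gemb (lexx 1) (lexx e).
  by rewrite mul1r.
have [||| Z [inlZ [inrZ [inlZN inrZN ZD Zext]]]] :=
  @amalgam_embedding _ _ f e (1 + t) (4%:R * e) e0 femb; [lra|lra|lra|].
have := inlUN; move/(isometricE S) => inlUN'.
have := inlZN; move/(isometricE S) => inlZN'.
have aN' := aN; move/(isometricE S): aN' => aN'.
have [X0 [i [iN X0P iP X0E]]] := isometric_range S inlZN aN.
have [Y0 [j [jN Y0P jP Y0E]]] := isometric_range S inlUN bN.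
have [j' j'e j'j] := hG (S t) U Y0 j St0 jN.
move/(eps_embeddingE S): j'e => j'e.
have j'b y : j' (inlU y) = b y.
  by have := j'j (vsproj Y0 (inlU y)); rewrite /= vsprojK // jP.
have t2 : 1 + t <= 2%:R by lra.
have [|||TZ [nTZ TZl TZr]] := Zext G (P \o a) (j' \o inrU \o T').
- by move=> x /=; rewrite -(aN' x).
- move=> y /=; apply: le_trans (j'e _).2 _; rewrite inrUN mul1r.
  by rewrite ler_wpM2l //; lra.
- move=> x /=; rewrite PT -j'b -linearB; apply: le_trans (j'e _).2 _.
  have h1 := UD (T x); have h2 := Tfg x.
  have := nrm_dist S (inlU (T x)) (inrU (g (T x))) (inrU (T' (f x))).
  rewrite -[in X in _ <= _ + X]linearB inrUN mul1r [nrm (g _ - _)]nrmBC.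
  rewrite [nrm (inlU _ - inrU (g _))]nrmBC.
  have := ler_wpM2l (ltW e0) (nT x).
  have := ler_wpM2r (nrm_ge0 S (inlU (T x) - inrU (T' (f x)))) t2.
  have := mulr_ge0 (ltW e0) (nrm_ge0 S x); lra.
have := hP Z X0 TZ i (S t).
case => //.
- by apply/(nonexpansiveE S).
- move=> x0; have [x1 xE] := X0E x0.
  by rewrite /= -{1}(vsvalK x0) xE iP TZl.
move=> i' [i'e /(opnorm_leE S) i'i /(opnorm_leE S) TT].
move/(eps_embeddingE S): i'e => i'e.
exists (i' \o inrZ), (j' \o inrU); split.
- apply/(eps_embeddingE S) => x /=; have := i'e (inrZ x); rewrite inrZN.
  have n0 := nrm_ge0 S x.
  have := ler_wpM2r n0 tt; have := mulr_ge0 (ltW t0) n0; rewrite -td => ? ?.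
  by move=> [? ?]; split; lra.
- apply/(eps_embeddingE S) => x /=; have := j'e (inrU x); rewrite inrUN mul1r.
  have := mulr_ge0 (ltW t0) (nrm_ge0 S x); rewrite -td => ? [? ?]; split; lra.
- move=> x /=; have := TT (inrZ x); rewrite /= TZr inrZN /=.
  have n0 := nrm_ge0 S x.
  have := ler_wpM2r n0 tt; have := mulr_ge0 (ltW t0) n0; rewrite -td; lra.
- move=> x /=.
  have := i'i (vsproj X0 (inlZ x)); rewrite /= vsprojK // iP.
  have -> : nrm (vsproj X0 (inlZ x)) = nrm x.
    by rewrite -inlZN' -[in RHS](vsprojK (X0P x)).
  have := (i'e (inrZ (f x) - inlZ x)).2; rewrite linearB.
  have := nrm_dist S (i' (inrZ (f x))) (i' (inlZ x)) (a x).
  have := ler_wpM2r (nrm_ge0 S (inrZ (f x) - inlZ x)) t2.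
  have te' : t <= e by lra.
  have := mulr_ge0 (ltW e0) (nrm_ge0 S x).
  have := ZD x; have := ler_wpM2r (nrm_ge0 S x) te'; lra.
- move=> x /=; rewrite -j'b -linearB; apply: le_trans (j'e _).2 _.
  have := ler_wpM2r (nrm_ge0 S (inrU (g x) - inlU x)) t2.
  have := mulr_ge0 (ltW e0) (nrm_ge0 S x).
  have := UD x; lra.
Qed.

End Extension.

(** * Partial isomorphisms *)

Section PartialIsomorphisms.
Variables (R : realType) (K : numFieldType) (S : real_scale R K).
Local Notation nrm := (nrm S).

(** [A] and [B] are the graphs of e-embeddings, defined on the
    finite-dimensional subspaces [a X] of [V] and [b Y] of [W], where [P] maps
    the former into the latter; these embeddings intertwine [P] and [Q] up
    to [e]. *)
Definition partial_iso (V W V' W' : normedModType K)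
    (P : {linear V -> W}) (Q : {linear V' -> W'}) (e : R)
    (A : set (V * V')) (B : set (W * W')) :=
  exists (X Y : finDimNormedType K) (T : {linear X -> Y})
    (a : {linear X -> V}) (b : {linear Y -> W})
    (f : {linear X -> V'}) (g : {linear Y -> W'}),
  [/\ nonexpansive T /\ (forall x, P (a x) = b (T x)),
      isometric a /\ isometric b,
      eps_embedding (S e) f /\ eps_embedding (S e) g,
      forall x, nrm (Q (f x) - g (T x)) <= e * nrm x &
      A = range (fun x => (a x, f x)) /\ B = range (fun y => (b y, g y))].

(** The partial isomorphism between zero subspaces. *)
Lemma partial_iso0 (V W V' W' : normedModType K)
    (P : {linear V -> W}) (Q : {linear V' -> W'}) (e : R) :
  0 < e -> exists A B, partial_iso P Q e A B.
Proof.
move=> e0.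
have [||| X [t [t' [tK t'K tN]]]] :=
  @renorm_exists _ _ S 'rV[K]_0 (fun=> 0) => //.
- by move=> a x /=; rewrite mulr0.
- by move=> x _; apply/rowP; case.
have X0 (x : X) : nrm x = 0 by rewrite -(t'K x) tN.
have zero (U : normedModType K) : exists z : {linear X -> U}, forall x, z x = 0.
  by apply: linear_fun_exists => a x y; rewrite scaler0 addr0.
have [T T0] := zero X; have [a a0] := zero V; have [b b0] := zero W.
have [f f0] := zero V'; have [g g0] := zero W'.
exists (range (fun x => (a x, f x))), (range (fun x => (b x, g x))).
exists X, X, T, a, b, f, g; split=> //.
- split; first by apply/(nonexpansiveE S) => x; rewrite !X0.
  by move=> x; rewrite a0 b0 linear0.
- by split; apply/(isometricE S) => x; rewrite ?a0 ?b0 nrm0 X0.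
- by split; apply/(eps_embeddingE S) => x; rewrite ?f0 ?g0 nrm0 X0 !mulr0.
- by move=> x; rewrite f0 g0 linear0 subr0 nrm0 X0 mulr0.
Qed.

(** The roles of [P] and [Q] are exchanged. The new finite-dimensional operator
    is a restriction of [Q]: its domain is spanned by the range of [f] and [v'],
    its codomain by the range of [g], the image of that domain under [Q], and
    [w']. The extension property embeds it into [P]. *)
Lemma partial_iso_half_step (V W V' W' : normedModType K)
    (P : {linear V -> W}) (Q : {linear V' -> W'}) (e d : R)
    (A : set (V * V')) (B : set (W * W')) (v' : V') (w' : W') :
    extension_property S P -> nonexpansive Q ->
    0 < e <= 1 -> 0 < d <= e -> partial_iso P Q e A B ->
  exists (A' : set (V' * V)) (B' : set (W' * W)),
    [/\ partial_iso Q P d A' B',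
      forall p, A p -> exists2 u, A' (p.2, u) &
        nrm (u - p.1) <= 10%:R * e * nrm p.1,
      forall p, B p -> exists2 u, B' (p.2, u) &
        nrm (u - p.1) <= 10%:R * e * nrm p.1,
      exists u, A' (v', u) & exists u, B' (w', u)].
Proof.
move=> extP nQ e01 d0e [X [Y [T [a [b [f [g]]]]]]].
move=> [[nT PT] [aN bN] [fe ge] Qfg [-> ->]].
move/(nonexpansiveE S): nQ => nQ.
have [hX hXE] : exists h : {linear (X * K^o)%type -> V'},
    h =1 fun p => f p.1 + p.2 *: v'.
  apply: linear_fun_exists => c x y /=; rewrite linearP scalerDl -scalerA.
  by rewrite scalerDr addrACA.
have [X' [a' [sX [a'N a'E]]]] := image_fin_dim S hX.
have [hY hYE] : exists h : {linear (Y * X' * K^o)%type -> W'},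
    h =1 fun p => g p.1.1 + Q (a' p.1.2) + p.2 *: w'.
  apply: linear_fun_exists => c x y /=.
  have -> (p q : Y) : g (c *: p + q) = c *: g p + g q by rewrite linearP.
  have -> (p q : X') : Q (a' (c *: p + q)) = c *: Q (a' p) + Q (a' q).
    by rewrite !linearP.
  rewrite scalerDl -scalerA !scalerDr (addrACA (c *: g x.1.1) (g y.1.1)).
  by rewrite [LHS]addrACA.
have [Y' [b' [sY [b'N b'E]]]] := image_fin_dim S hY.
have [f1 f1E] : exists h : {linear X -> X'}, h =1 fun x => sX (x, 0).
  apply: linear_fun_exists => c x y /=; rewrite -linearP; congr (sX _).
  by apply: injective_projections => /=; rewrite ?scaler0 ?addr0.
have [g1 g1E] : exists h : {linear Y -> Y'}, h =1 fun y => sY (y, 0, 0).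
  apply: linear_fun_exists => c x y /=; rewrite -linearP; congr (sY _).
  by apply: injective_projections => /=;
    first apply: injective_projections => /=; rewrite ?scaler0 ?addr0.
have [T' T'E] : exists h : {linear X' -> Y'}, h =1 fun x => sY (0, x, 0).
  apply: linear_fun_exists => c x y /=; rewrite -linearP; congr (sY _).
  by apply: injective_projections => /=;
    first apply: injective_projections => /=; rewrite ?scaler0 ?addr0.
have af x : a' (f1 x) = f x.
  by rewrite f1E a'E hXE /= scale0r addr0.
have bg y : b' (g1 y) = g y.
  by rewrite g1E b'E hYE /= !linear0 scale0r !addr0.
have bT x : b' (T' x) = Q (a' x).
  by rewrite T'E b'E hYE /= linear0 scale0r addr0 add0r.
move/(isometricE S): (a'N) => a'N'; move/(isometricE S): (b'N) => b'N'.
have [||||f' [g' [f'e g'e Pf'g' f'f g'g]]] :=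
    extP X Y X' Y' T T' a b f1 g1 e d e01 d0e nT _ aN bN PT.
- by apply/(nonexpansiveE S) => x; rewrite -b'N' bT -(a'N' x).
- apply/(eps_embeddingE S) => x; rewrite -a'N' af.
  by apply: (iffLR (eps_embeddingE S _ _) fe).
- apply/(eps_embeddingE S) => x; rewrite -b'N' bg.
  by apply: (iffLR (eps_embeddingE S _ _) ge).
- by move=> x; rewrite -b'N' linearB bT af bg.
exists (range (fun x => (a' x, f' x))), (range (fun y => (b' y, g' y))).
split.
- exists X', Y', T', a', b', f', g'; split=> //; split=> //.
  by apply/(nonexpansiveE S) => x; rewrite -b'N' bT -(a'N' x).
- move=> _ [x _ <-] /=; exists (f' (f1 x)).
    by exists (f1 x) => //; rewrite af.
  by move/(isometricE S): aN => ->.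
- move=> _ [y _ <-] /=; exists (g' (g1 y)).
    by exists (g1 y) => //; rewrite bg.
  by move/(isometricE S): bN => ->.
- exists (f' (sX (0, 1))), (sX (0, 1)) => //; congr pair.
  by rewrite a'E hXE /= linear0 scale1r add0r.
- exists (g' (sY (0, 0, 1))), (sY (0, 0, 1)) => //; congr pair.
  by rewrite b'E hYE /= !linear0 scale1r !add0r.
Qed.

(** The sum norm on the product. *)
Definition pnrm (V V' : normedModType K) (p : V * V') : R := nrm p.1 + nrm p.2.

(** [A'] almost contains [A], up to a relative error [e], and its projections
    come relatively [e]-close to [v] and [v']. *)
Definition back_and_forth_step (V V' : normedModType K) (e : R) (v : V)
    (v' : V') (A A' : set (V * V')) :=
  [/\ forall p, A p -> exists2 q, A' q & pnrm (q - p) <= e * pnrm p,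
      exists2 p, A' p & nrm (p.1 - v) <= e * nrm v &
      exists2 p, A' p & nrm (p.2 - v') <= e * nrm v'].

Lemma partial_iso_step (V W V' W' : normedModType K)
    (P : {linear V -> W}) (Q : {linear V' -> W'}) (e d : R)
    (A : set (V * V')) (B : set (W * W')) (v : V) (v' : V') (w : W) (w' : W') :
    extension_property S P -> nonexpansive P ->
    extension_property S Q -> nonexpansive Q ->
    0 < e <= 1 -> 0 < d <= e -> partial_iso P Q e A B ->
  exists (A' : set (V * V')) (B' : set (W * W')),
    [/\ partial_iso P Q d A' B', back_and_forth_step (10%:R * e) v v' A A' &
      back_and_forth_step (10%:R * e) w w' B B'].
Proof.
move=> extP nP extQ nQ e01 d0e AB.
have [A1 [B1 [AB1 AA1 BB1 [v1 v1A] [w1 w1B]]]] :=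
  partial_iso_half_step v' w' extP nQ e01 d0e AB.
have /andP[e0 e1] := e01; have /andP[d0 de] := d0e.
have d01 : 0 < d <= 1 by lra.
have d0d : 0 < d <= d by lra.
have [A2 [B2 [AB2 AA2 BB2 [v2 v2A] [w2 w2B]]]] :=
  partial_iso_half_step v w extQ nP d01 d0d AB1.
exists A2, B2; split=> //; split.
- move=> p /AA1[u /AA2 /= [u' A2u u'p2] up1]; exists (u, u') => //.
  rewrite /pnrm /=; have := ler_wpM2r (nrm_ge0 S p.2) de; lra.
- exists (v, v2) => //=; rewrite subrr nrm0; have := nrm_ge0 S v; nra.
- have [u Au uv'] := AA2 _ v1A; exists (v1, u) => //=.
  have := ler_wpM2r (nrm_ge0 S v') de; move: uv' => /=; lra.
- move=> p /BB1[u /BB2 /= [u' B2u u'p2] up1]; exists (u, u') => //.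
  rewrite /pnrm /=; have := ler_wpM2r (nrm_ge0 S p.2) de; lra.
- exists (w, w2) => //=; rewrite subrr nrm0; have := nrm_ge0 S w; nra.
- have [u Bu uw'] := BB2 _ w1B; exists (w1, u) => //=.
  have := ler_wpM2r (nrm_ge0 S w') de; move: uw' => /=; lra.
Qed.

End PartialIsomorphisms.

(** * Limits of linear relations *)

Section Limits.
Variables (R : realType) (K : numFieldType) (S : real_scale R K).
Local Notation nrm := (nrm S).
Local Notation pnrm := (pnrm S).

(* The errors of the construction are multiples of [h n = 2 ^ - n]. *)
Local Notation h n := ((2%:R^-1 : R) ^+ n).

Lemma half_pow_gt0 n : 0 < h n.
Proof. by rewrite exprn_gt0 // invr_gt0. Qed.

Lemma half_pow_le1 n : h n <= 1.
Proof. by rewrite exprn_ile1 // ?invr_ge0 // invf_le1 // ler1n. Qed.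

Lemma half_powS n : h n = 2%:R * h n.+1.
Proof. by rewrite exprS mulrA mulfV ?mul1r. Qed.

Lemma half_pow_small (C e : R) : 0 < e ->
  exists N, forall n, (N <= n)%N -> h n * C <= e.
Proof.
move=> e0.
have : (fun n => h n * C) @ \oo --> 0 * C.
  apply: cvgM; last exact: cvg_cst.
  by apply: cvg_expr; rewrite ger0_norm ?invr_ge0 // invf_lt1 // ltr1n.
rewrite mul0r => /cvgrPdist_le/(_ _ e0)[N _ hN].
exists N => n Nn; have := hN n Nn; rewrite /= sub0r normrN.
by apply: le_trans; exact: ler_norm.
Qed.

Lemma separable_seq (V : normedModType K) : separable_space V ->
  exists d : nat -> V, forall v (e : R), 0 < e -> exists n, nrm (d n - v) <= e.
Proof.
move=> [D /countable_injP[f injf] dD].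
have /choice[d dP] : forall n, exists x, forall y, D y -> f y = n -> y = x.
  move=> n; have [[x [Dx fx]]|no] := pselect (exists x, D x /\ f x = n).
    exists x => y Dy fy; apply: injf; rewrite ?inE //.
    by rewrite fy fx.
  by exists 0 => y Dy fy; case: no; exists y.
exists d => v e e0.
have Se0 : 0 < S e by rewrite -(rmorph0 S) (emb_lt S).
have [||x [vx Dx]] := dD (ball v (S e)).
- by exists v; exact: ballxx.
- exact: ball_open.
exists (f x); rewrite -(dP _ _ Dx erefl) -(emb_le S) -(nrmE S) distrC ltW //.
by rewrite -ball_normE in vx.
Qed.

Lemma geometric_limit (V : completeNormedModType K) (u : nat -> V) (C : R) :
  0 <= C -> (forall n, nrm (u n.+1 - u n) <= C * h n.+1) ->
  exists l, forall n, nrm (l - u n) <= C * h n.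
Proof.
move=> C0 hu.
(* the bound telescopes, since [h n - h n.+1 = h n.+1] *)
have dist n k : nrm (u (n + k)%N - u n) <= C * h n - C * h (n + k)%N.
  elim: k => [|k IH]; first by rewrite addn0 !subrr nrm0.
  rewrite addnS; have := nrm_dist S (u (n + k).+1) (u (n + k)%N) (u n).
  have := hu (n + k)%N.
  have : C * h (n + k)%N = C * (2%:R * h (n + k).+1) by rewrite -half_powS.
  lra.
have dist' n m : (n <= m)%N -> nrm (u m - u n) <= C * h n.
  move=> nm; have := dist n (m - n)%N; rewrite subnKC //.
  have := mulr_ge0 C0 (ltW (half_pow_gt0 m)); lra.
have cu : cauchy (u @ \oo).
  apply: cauchy_exP => _ /(emb_gt0 S)[e e0 ->].
  have e20 : 0 < e / 2%:R by lra.
  have [N hN] := half_pow_small C e20.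
  exists (u N); exists N => // n /= Nn; rewrite -ball_normE /=.
  rewrite (nrmE S) (emb_lt S) nrmBC; apply: le_lt_trans (dist' _ _ Nn) _.
  have := hN _ (leqnn N); lra.
have /cauchy_cvgP/cvg_ex[l ul] := cu.
exists l => n; apply/ler_addgt0Pr => e e0.
have Se0 : 0 < S e by rewrite -(rmorph0 S) (emb_lt S).
move/cvgrPdist_le : ul => /(_ _ Se0)[N _ hN].
have := hN (maxn N n) (leq_maxl _ _); rewrite /= (nrmE S) (emb_le S).
have := dist' _ _ (leq_maxr N n).
have := nrm_dist S l (u (maxn N n)) (u n); lra.
Qed.

(** The second components of elements of [L] whose first components converge
    form a Cauchy sequence. *)
Lemma isometric_relation_total (V : normedModType K)
    (V' : completeNormedModType K) (L : set (V * V')) :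
    (forall p q, L p -> L q -> L (q - p)) ->
    (forall p, L p -> nrm p.2 = nrm p.1) ->
    (forall p, (forall e, 0 < e -> exists2 q, L q & pnrm (q - p) <= e) ->
      L p) ->
    (forall v (e : R), 0 < e -> exists2 p, L p & nrm (p.1 - v) <= e) ->
  forall v, exists v', L (v, v').
Proof.
move=> LB LN Lcl Ldense v.
have /choice[p pP] : forall n, exists p, L p /\ nrm (p.1 - v) <= h n.+2.
  by move=> n; have [p] := Ldense v _ (half_pow_gt0 n.+2); exists p.
have [//||l lP] := @geometric_limit V' (fun n => (p n).2) 1.
  move=> n /=; have [Ln pn] := pP n; have [Ln1 pn1] := pP n.+1.
  have /= -> := LN _ (LB _ _ Ln Ln1).
  have := nrm_dist S (p n.+1).1 v (p n).1; rewrite [nrm (v - _)]nrmBC.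
  have := half_powS n.+1; have := half_powS n.+2.
  have := half_pow_gt0 n.+3; lra.
exists l; apply: Lcl => e e0; have [N hN] := half_pow_small 2%:R e0.
have [LN' pN] := pP N; exists (p N) => //; rewrite /pnrm /=.
have := lP N; rewrite nrmBC; have := hN _ (leqnn N).
have := half_powS N; have := half_powS N.+1; have := half_pow_gt0 N.+2; lra.
Qed.

(** A closed linear relation that preserves the norm and has dense projections
    is the graph of a bijective isometry. *)
Lemma isometric_relation_graph (V V' : completeNormedModType K)
    (L : set (V * V')) :
    (forall a p q, L p -> L q -> L (a *: p + q)) ->
    (forall p, L p -> nrm p.2 = nrm p.1) ->
    (forall p, (forall e, 0 < e -> exists2 q, L q & pnrm (q - p) <= e) ->
      L p) ->
    (forall v (e : R), 0 < e -> exists2 p, L p & nrm (p.1 - v) <= e) ->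
    (forall v (e : R), 0 < e -> exists2 p, L p & nrm (p.2 - v) <= e) ->
  exists j : {linear V -> V'}, [/\ bijective j, isometric j &
    forall p, L p <-> p.2 = j p.1].
Proof.
move=> Llin LN Lcl Ld1 Ld2.
have LB p q : L p -> L q -> L (q - p).
  by move=> Lp Lq; rewrite addrC -scaleN1r; apply: Llin.
have /choice[j jP] := isometric_relation_total LB LN Lcl Ld1.
have /choice[g gP] : forall v', exists v, L (v, v').
  apply: (@isometric_relation_total V' V [set p | L (p.2, p.1)]) => /=.
  - by move=> p q; apply: LB.
  - by move=> p /LN /= ->.
  - move=> p hp; apply: Lcl => e /hp[q Lq qp]; exists (q.2, q.1) => //.
    by move: qp; rewrite /pnrm /= addrC.
  - by move=> v e /(Ld2 v)[p Lp pv]; exists (p.2, p.1) => //=; case: p Lp pv.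
have uniq2 v v1 v2 : L (v, v1) -> L (v, v2) -> v1 = v2.
  move=> L1 L2; apply/esym/subr0_eq/(@nrm0_eq0 _ _ S).
  by have /= -> := LN _ (LB _ _ L1 L2); rewrite subrr nrm0.
have uniq1 v v1 v2 : L (v1, v) -> L (v2, v) -> v1 = v2.
  move=> L1 L2; apply/esym/subr0_eq/(@nrm0_eq0 _ _ S).
  by have /= <- := LN _ (LB _ _ L1 L2); rewrite subrr nrm0.
have [J JE] : exists J : {linear V -> V'}, J =1 j.
  apply: linear_fun_exists => a x y; apply: uniq2 (jP _) _.
  exact: (Llin a _ _ (jP x) (jP y)).
exists J; split.
- exists g => x; rewrite JE; first exact: uniq1 (gP _) (jP _).
  exact: uniq2 (jP _) (gP _).
- by apply/(isometricE S) => x; rewrite JE; exact: (LN _ (jP x)).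
- move=> [v v'] /=; rewrite JE; split=> [Lv|->]; last exact: jP.
  exact: uniq2 Lv (jP _).
Qed.

(** The lower limit of a sequence of relations: the pairs whose distance to
    [A n] tends to 0. *)
Definition liminf_rel (V V' : normedModType K) (A : nat -> set (V * V')) :
    set (V * V') :=
  [set p | forall e, 0 < e -> exists N, forall n, (N <= n)%N ->
    exists2 q, A n q & pnrm (q - p) <= e].

Lemma pnrm_ge0 (V V' : normedModType K) (p : V * V') : 0 <= pnrm p.
Proof. by rewrite addr_ge0 ?nrm_ge0. Qed.

Lemma pnrmD (V V' : normedModType K) (p q : V * V') :
  pnrm (p + q) <= pnrm p + pnrm q.
Proof.
by rewrite /pnrm /=; have := nrmD S p.1 q.1; have := nrmD S p.2 q.2; lra.
Qed.

Lemma pnrm_dist (V V' : normedModType K) (p q r : V * V') :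
  pnrm (p - r) <= pnrm (p - q) + pnrm (q - r).
Proof. by have := pnrmD (p - q) (q - r); rewrite addrA subrK. Qed.

Lemma pnrmZ (V V' : normedModType K) a (p : V * V') :
  pnrm (a *: p) = real_part S `|a| * pnrm p.
Proof. by rewrite /pnrm /= !nrmZ mulrDr. Qed.

Section BackAndForth.
Variables (V V' : completeNormedModType K) (A : nat -> set (V * V')).
Hypothesis Alin : forall n a p q, A n p -> A n q -> A n (a *: p + q).
Hypothesis Anrm : forall n p, A n p ->
  nrm p.2 <= (1 + h n) * nrm p.1 /\ nrm p.1 <= (1 + h n) * nrm p.2.
Hypothesis Astep : forall n p, A n p ->
  exists2 q, A n.+1 q & pnrm (q - p) <= h n / 4%:R * pnrm p.

Lemma liminf_lin a p q : liminf_rel A p -> liminf_rel A q ->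
  liminf_rel A (a *: p + q).
Proof.
move=> Lp Lq e e0; pose r := real_part S `|a|.
have r0 : 0 <= r := real_part_norm_ge0 S a.
have e1 : 0 < e / (2%:R * (r + 1)) by rewrite divr_gt0 // mulr_gt0 //; lra.
have e2 : 0 < e / 2%:R by lra.
have [N1 h1] := Lp _ e1; have [N2 h2] := Lq _ e2.
exists (maxn N1 N2) => n; rewrite geq_max.
move=> /andP[/h1[p1 Ap1 pp1] /h2[q1 Aq1 qq1]].
exists (a *: p1 + q1); first exact: Alin.
rewrite opprD addrACA -scalerBr; apply: le_trans (pnrmD _ _) _.
rewrite pnrmZ -/r; suff : r * pnrm (p1 - p) <= e / 2%:R by lra.
have e1E : (r + 1) * (e / (2%:R * (r + 1))) = e / 2%:R.
  by field; apply/eqP; lra.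
have := pnrm_ge0 (p1 - p); have := ler_wpM2l r0 pp1; lra.
Qed.

Lemma liminf_nrm p : liminf_rel A p -> nrm p.2 = nrm p.1.
Proof.
move=> Lp.
have key e : 0 < e -> nrm p.2 <= nrm p.1 + e /\ nrm p.1 <= nrm p.2 + e.
  move=> e0; have e3 : 0 < e / 4%:R by lra.
  have [N1 hN1] := Lp _ e3.
  have [N2 hN2] := half_pow_small (nrm p.1 + nrm p.2 + e) e3.
  have [q Aq] := hN1 _ (leq_maxl N1 N2); rewrite /pnrm /= => qp.
  have := hN2 _ (leq_maxr N1 N2); have [] := Anrm Aq.
  set m := maxn _ _.
  have := nrm_le_dist S q.1 p.1; have := nrm_le_dist S q.2 p.2.
  have := nrm_le_dist S p.1 q.1; have := nrm_le_dist S p.2 q.2.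
  rewrite [nrm (p.1 - _)]nrmBC [nrm (p.2 - _)]nrmBC.
  have := nrm_ge0 S (q.1 - p.1); have := nrm_ge0 S (q.2 - p.2) => d2 d1.
  move=> a1 a2 a3 a4.
  have b1 : h m * nrm q.1 <= h m * (nrm p.1 + nrm p.2 + e).
    by apply: ler_wpM2l; [exact/ltW/half_pow_gt0|have := nrm_ge0 S p.2; lra].
  have b2 : h m * nrm q.2 <= h m * (nrm p.1 + nrm p.2 + e).
    by apply: ler_wpM2l; [exact/ltW/half_pow_gt0|have := nrm_ge0 S p.1; lra].
  by move=> a5 a6 a7; split; lra.
by apply/le_anti/andP; split; apply/ler_addgt0Pr => e /key[].
Qed.

Lemma liminf_closed p :
  (forall e, 0 < e -> exists2 q, liminf_rel A q & pnrm (q - p) <= e) ->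
  liminf_rel A p.
Proof.
move=> hp e e0; have e2 : 0 < e / 2%:R by lra.
have [q /(_ _ e2)[N hN] qp] := hp _ e2.
exists N => n /hN[r Ar rq]; exists r => //.
have := pnrm_dist r q p; lra.
Qed.

(** A pair of [A n] is followed through the later relations; the corrections
    form a geometric series, and the pairs converge to an element of the lower
    limit. *)
Lemma liminf_track n p : A n p ->
  exists2 q, liminf_rel A q & pnrm (q - p) <= 2%:R * h n * pnrm p.
Proof.
move=> Anp.
have /choice[F FP] : forall mp : nat * (V * V'), exists q, A mp.1 mp.2 ->
    A mp.1.+1 q /\ pnrm (q - mp.2) <= h mp.1 / 4%:R * pnrm mp.2.
  move=> [m q]; have [Amq|nA] := pselect (A m q); last by exists 0.
  by have [r Ar rq] := Astep Amq; exists r.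
pose u := fix u k := if k is k'.+1 then F ((n + k')%N, u k') else p.
have Au k : A (n + k)%N (u k).
  elim: k => [|k IH]; first by rewrite addn0.
  by rewrite addnS; have [] := FP ((n + k)%N, u k) IH.
have du k : pnrm (u k.+1 - u k) <= h (n + k)%N / 4%:R * pnrm (u k).
  by have [] := FP ((n + k)%N, u k) (Au k).
pose C := pnrm p; have C0 : 0 <= C := pnrm_ge0 p.
(* a multiplicative bound that survives since
   [(1 + h m / 4) * (2 - h m) <= 2 - h m.+1] *)
have bu k : pnrm (u k) <= (2%:R - h (n + k)%N) * C.
  elim: k => [|k IH].
    by rewrite addn0 /= -/C ler_peMl //; have := half_pow_le1 n; lra.
  have := pnrmD (u k) (u k.+1 - u k); rewrite addrC subrK.
  have := du k; rewrite addnS; set x := h (n + k)%N.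
  have x0 : 0 < x := half_pow_gt0 _.
  have xE : x * C = 2%:R * h (n + k).+1 * C by rewrite -half_powS.
  have : x * pnrm (u k) <= x * ((2%:R - x) * C) by rewrite ler_wpM2l // ltW.
  have : 0 <= x * x * C by rewrite !mulr_ge0 // ltW.
  move: IH xE; rewrite -/x; set y := h (n + k).+1; clearbody x y.
  lra.
have du' k : pnrm (u k.+1 - u k) <= h n * C * h k.+1.
  have xE : h n * C * h k.+1 = h (n + k)%N * C / 2%:R.
    by rewrite exprS exprD; ring.
  rewrite xE; apply: le_trans (du k) _.
  have x0 : 0 < h (n + k)%N := half_pow_gt0 _.
  have : h (n + k)%N * pnrm (u k) <= h (n + k)%N * (2%:R * C).
    apply: ler_wpM2l; first exact: ltW.
    have := bu k; have := mulr_ge0 (ltW x0) C0; lra.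
  lra.
have D0 : 0 <= h n * C by rewrite mulr_ge0 // ltW // half_pow_gt0.
have [|l lP] := @geometric_limit V (fun k => (u k).1) (h n * C) D0.
  move=> k; have := du' k; rewrite /pnrm /=.
  have := nrm_ge0 S ((u k.+1).2 - (u k).2); lra.
have [|l' lP'] := @geometric_limit V' (fun k => (u k).2) (h n * C) D0.
  move=> k; have := du' k; rewrite /pnrm /=.
  have := nrm_ge0 S ((u k.+1).1 - (u k).1); lra.
have lu k : pnrm ((l, l') - u k) <= 2%:R * (h n * C) * h k.
  by rewrite /pnrm /=; have := lP k; have := lP' k; lra.
exists (l, l'); last by have := lu 0%N; rewrite /= expr0 -/C; lra.
move=> e e0; have [N hN] := half_pow_small (2%:R * (h n * C)) e0.
exists (n + N)%N => m Nm; exists (u (m - n)%N).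
  have := Au (m - n)%N; rewrite subnKC //; apply: leq_trans Nm.
  exact: leq_addr.
have := lu (m - n)%N; have := hN (m - n)%N; rewrite leq_subRL; last first.
  by apply: leq_trans Nm; exact: leq_addr.
move=> /(_ Nm) ? ?.
have -> : pnrm (u (m - n)%N - (l, l')) = pnrm ((l, l') - u (m - n)%N).
  by rewrite /pnrm /= nrmBC [nrm (_ - l')]nrmBC.
lra.
Qed.

End BackAndForth.

Lemma infinitely_often : exists c : nat -> nat,
  forall k N, exists2 n, (N <= n)%N & c n = k.
Proof.
(* [n.+1 = 2 ^ k * (2 * N).+1] has 2-adic valuation [k] *)
exists (fun n => logn 2 n.+1) => k N.
have pos : (0 < 2 ^ k * (2 * N).+1)%N by rewrite muln_gt0 expn_gt0.
exists (2 ^ k * (2 * N).+1).-1%N.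
  rewrite -ltnS prednK //.
  apply: (@leq_trans (1 * (2 * N).+1)).
    by rewrite mul1n ltnS leq_pmull.
  by rewrite leq_mul // expn_gt0.
rewrite prednK // lognM ?expn_gt0 // pfactorK // logn_coprime ?addn0 //.
by rewrite prime_coprime // dvdn2 /= oddM.
Qed.

(** The sequence [c] runs infinitely often through every index, so that each
    term of the dense sequences [d] and [d'] is approximated with errors that
    tend to 0. *)
Lemma liminf_graph (V V' : completeNormedModType K)
    (A : nat -> set (V * V')) (c : nat -> nat) (d : nat -> V) (d' : nat -> V') :
    (forall n a p q, A n p -> A n q -> A n (a *: p + q)) ->
    (forall n p, A n p ->
      nrm p.2 <= (1 + h n) * nrm p.1 /\ nrm p.1 <= (1 + h n) * nrm p.2) ->
    (forall k N, exists2 n, (N <= n)%N & c n = k) ->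
    (forall v (e : R), 0 < e -> exists n, nrm (d n - v) <= e) ->
    (forall v (e : R), 0 < e -> exists n, nrm (d' n - v) <= e) ->
    (forall n, back_and_forth_step S (h n / 4%:R) (d (c n)) (d' (c n))
      (A n) (A n.+1)) ->
  exists j : {linear V -> V'}, [/\ bijective j, isometric j &
    forall p, liminf_rel A p <-> p.2 = j p.1].
Proof.
move=> Alin Anrm cinf dd dd' Astep.
have step n p : A n p ->
    exists2 q, A n.+1 q & pnrm (q - p) <= h n / 4%:R * pnrm p.
  by have [h1 _ _] := Astep n; exact: h1.
have near n p (D : R) :
    A n.+1 p -> nrm p.1 <= 2%:R * D \/ nrm p.2 <= 2%:R * D ->
    exists2 q, liminf_rel A q & pnrm (q - p) <= 6%:R * (h n * D).
  move=> Ap pD; have [q Lq qp] := liminf_track step Ap.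
  exists q => //; apply: le_trans qp _; rewrite -half_powS.
  have hn := half_pow_gt0 n; rewrite [leRHS]mulrCA ler_pM2l //.
  have [n1 n2] := Anrm _ _ Ap; rewrite /pnrm.
  have := ler_wpM2r (nrm_ge0 S p.1) (half_pow_le1 n.+1).
  have := ler_wpM2r (nrm_ge0 S p.2) (half_pow_le1 n.+1).
  by case: pD; lra.
apply: isometric_relation_graph.
- exact: liminf_lin.
- exact: liminf_nrm.
- exact: liminf_closed.
- move=> v e e0; have e2 : 0 < e / 2%:R by lra.
  have [k kP] := dd v _ e2.
  have [N hN] := half_pow_small (10%:R * nrm (d k)) e2.
  have [n /hN hn cn] := cinf k N; have [_ [p Ap pd] _] := Astep n.
  rewrite cn in pd.
  have hd := ler_wpM2r (nrm_ge0 S (d k)) (half_pow_le1 n).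
  have hd0 := mulr_ge0 (ltW (half_pow_gt0 n)) (nrm_ge0 S (d k)).
  have [||q Lq qp] := near n p (nrm (d k)) => //.
    by left; have := nrm_le_dist S p.1 (d k); lra.
  exists q => //; move: qp; rewrite /pnrm /=.
  have := nrm_ge0 S (q.2 - p.2); have := nrm_dist S q.1 p.1 v.
  have := nrm_dist S p.1 (d k) v; lra.
- move=> v e e0; have e2 : 0 < e / 2%:R by lra.
  have [k kP] := dd' v _ e2.
  have [N hN] := half_pow_small (10%:R * nrm (d' k)) e2.
  have [n /hN hn cn] := cinf k N; have [_ _ [p Ap pd]] := Astep n.
  rewrite cn in pd.
  have hd := ler_wpM2r (nrm_ge0 S (d' k)) (half_pow_le1 n).
  have hd0 := mulr_ge0 (ltW (half_pow_gt0 n)) (nrm_ge0 S (d' k)).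
  have [||q Lq qp] := near n p (nrm (d' k)) => //.
    by right; have := nrm_le_dist S p.2 (d' k); lra.
  exists q => //; move: qp; rewrite /pnrm /=.
  have := nrm_ge0 S (q.1 - p.1); have := nrm_dist S q.2 p.2 v.
  have := nrm_dist S p.2 (d' k) v; lra.
Qed.

End Limits.

(** * Uniqueness of operators with the extension property *)

Section Uniqueness.
Variables (R : realType) (K : numFieldType) (S : real_scale R K).
Local Notation nrm := (nrm S).
Local Notation pnrm := (pnrm S).
Local Notation h n := ((2%:R^-1 : R) ^+ n).

Section PartialIso.
Variables (V W V' W' : normedModType K).
Variables (P : {linear V -> W}) (Q : {linear V' -> W'}) (e : R).
Variables (A : set (V * V')) (B : set (W * W')).
Hypothesis AB : partial_iso S P Q e A B.

Lemma partial_iso_lin1 a p q : A p -> A q -> A (a *: p + q).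
Proof.
have [X [Y [T [u [v [f [g [_ _ _ _ [-> _]]]]]]]]] := AB.
by move=> [x _ <-] [y _ <-]; exists (a *: x + y); rewrite // !linearP.
Qed.

Lemma partial_iso_lin2 a p q : B p -> B q -> B (a *: p + q).
Proof.
have [X [Y [T [u [v [f [g [_ _ _ _ [_ ->]]]]]]]]] := AB.
by move=> [x _ <-] [y _ <-]; exists (a *: x + y); rewrite // !linearP.
Qed.

Lemma partial_iso_nrm1 p : A p ->
  (1 - e) * nrm p.1 <= nrm p.2 /\ nrm p.2 <= (1 + e) * nrm p.1.
Proof.
have [X [Y [T [u [v [f [g [_ [uN _] [fe _] _ [-> _]]]]]]]]] := AB.
move/(isometricE S): uN => uN; move/(eps_embeddingE S): fe => fe.
by move=> [x _ <-] /=; rewrite uN.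
Qed.

Lemma partial_iso_nrm2 p : B p ->
  (1 - e) * nrm p.1 <= nrm p.2 /\ nrm p.2 <= (1 + e) * nrm p.1.
Proof.
have [X [Y [T [u [v [f [g [_ [_ vN] [_ ge] _ [_ ->]]]]]]]]] := AB.
move/(isometricE S): vN => vN; move/(eps_embeddingE S): ge => ge.
by move=> [x _ <-] /=; rewrite vN.
Qed.

Lemma partial_iso_map p : A p ->
  exists2 z, B (P p.1, z) & nrm (z - Q p.2) <= e * nrm p.1.
Proof.
have [X [Y [T [u [v [f [g [[_ PT] [uN _] _ Qfg [-> ->]]]]]]]]] := AB.
move/(isometricE S): uN => uN.
move=> [x _ <-] /=; exists (g (T x)); first by exists (T x); rewrite ?PT.
by rewrite nrmBC uN.
Qed.

End PartialIso.

(** Step [n] of the back-and-forth has error [h n / 40], so that its graphs move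
    by at most [h n / 4] relatively to the norm. *)
Theorem extension_property_unique (V W V' W' : completeNormedModType K)
    (P : {linear V -> W}) (Q : {linear V' -> W'}) :
    separable_space V -> separable_space W ->
    separable_space V' -> separable_space W' ->
    nonexpansive P -> nonexpansive Q ->
    extension_property S P -> extension_property S Q ->
  exists (j : {linear V -> V'}) (i : {linear W -> W'}),
    [/\ bijective j /\ isometric j, bijective i /\ isometric i &
        Q \o j =1 i \o P].
Proof.
move=> /(separable_seq S)[dV dVP] /(separable_seq S)[dW dWP].
move=> /(separable_seq S)[dV' dVP'] /(separable_seq S)[dW' dWP'].
move=> nP nQ eP eQ.
have [c cP] := infinitely_often.
pose good n (AB : set (V * V') * set (W * W')) :=
  partial_iso S P Q (h n / 40%:R) AB.1 AB.2.
pose next n (AB AB' : set (V * V') * set (W * W')) :=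
  back_and_forth_step S (h n / 4%:R) (dV (c n)) (dV' (c n)) AB.1 AB'.1 /\
  back_and_forth_step S (h n / 4%:R) (dW (c n)) (dW' (c n)) AB.2 AB'.2.
have /choice[F FP] : forall x : nat * (set (V * V') * set (W * W')),
    exists AB', good x.1 x.2 -> good x.1.+1 AB' /\ next x.1 x.2 AB'.
  move=> [n [A B]]; rewrite /good /next /=.
  have [gAB|] := pselect (partial_iso S P Q (h n / 40%:R) A B); last first.
    by move=> nAB; exists (A, B).
  have e01 : 0 < h n / 40%:R <= 1.
    have := half_pow_gt0 R n; have := half_pow_le1 R n => ? ?.
    by apply/andP; split; lra.
  have d0e : 0 < h n.+1 / 40%:R <= h n / 40%:R.
    have := half_pow_gt0 R n.+1; rewrite (half_powS _ n) => ?.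
    by apply/andP; split; lra.
  have [A' [B' [AB' AA' BB']]] := partial_iso_step (dV (c n)) (dV' (c n))
    (dW (c n)) (dW' (c n)) eP nP eQ nQ e01 d0e gAB.
  exists (A', B') => _; have -> : h n / 4%:R = 10%:R * (h n / 40%:R) by field.
  by [].
have h0 : 0 < h 0 / 40%:R by rewrite expr0; lra.
have [A0 [B0 AB0]] := partial_iso0 S P Q h0.
pose AB := fix AB n := if n is n'.+1 then F (n', AB n') else (A0, B0).
have gAB n : good n (AB n).
  by elim: n => // n IH; have [] := FP (n, AB n) IH.
have nAB n : next n (AB n) (AB n.+1).
  by have [] := FP (n, AB n) (gAB n).
(* an e-embedding satisfies symmetric bounds, with a larger constant *)
have nrm_equiv n (x y : R) : 0 <= x ->
    (1 - h n / 40%:R) * x <= y /\ y <= (1 + h n / 40%:R) * x ->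
    y <= (1 + h n) * x /\ x <= (1 + h n) * y.
  have := half_pow_gt0 R n; have := half_pow_le1 R n.
  move: (h n) => t t1 t0 x0 [xy yx].
  have tx := mulr_ge0 (ltW t0) x0.
  have := ler_wpM2r tx t1; have := ler_wpM2l (ltW t0) xy; split; lra.
have [||//|//|//|//|j [jb jN jE]] :=
    @liminf_graph _ _ S V V' (fun n => (AB n).1) c dV dV'.
- by move=> n a p q; exact: (partial_iso_lin1 (gAB n) a).
- move=> n p /(partial_iso_nrm1 (gAB n)); apply: nrm_equiv; exact: nrm_ge0.
- by move=> n; have [] := nAB n.
have [||//|//|//|//|i [ib iN iE]] :=
    @liminf_graph _ _ S W W' (fun n => (AB n).2) c dW dW'.
- by move=> n a p q; exact: (partial_iso_lin2 (gAB n) a).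
- move=> n p /(partial_iso_nrm2 (gAB n)); apply: nrm_equiv; exact: nrm_ge0.
- by move=> n; have [] := nAB n.
exists j, i; split=> // v /=.
(* the limit of the graphs [B] contains the image of the limit of the graphs
   [A] under the map that sends [(v, v')] to [(P v, Q v')] *)
suff : liminf_rel S (fun n => (AB n).2) (P v, Q (j v)) by move/iE.
have /jE Lv : (v, j v).2 = j (v, j v).1 by [].
move=> e e0; have e2 : 0 < e / 2%:R by lra.
have [N1 hN1] := Lv _ e2; have [N2 hN2] := half_pow_small (nrm v + e) e2.
exists (maxn N1 N2) => n; rewrite geq_max => /andP[/hN1[q Aq qv] /hN2 hn].
have [z Bz zq] := partial_iso_map (gAB n) Aq.
exists (P q.1, z) => //; move: qv; rewrite /pnrm /= => qv.
move/(nonexpansiveE S): (nP) => nP'; move/(nonexpansiveE S): (nQ) => nQ'.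
have := nP' (q.1 - v); have := nQ' (q.2 - j v); rewrite !linearB.
have := nrm_dist S z (Q q.2) (Q (j v)).
have hq : h n / 40%:R * nrm q.1 <= e / 2%:R.
  apply: le_trans hn; have t0 := half_pow_gt0 R n.
  rewrite -mulrA; apply: ler_wpM2l; first exact: ltW.
  have := nrm_le_dist S q.1 v; have := nrm_ge0 S (q.2 - j v).
  have := nrm_ge0 S q.1; lra.
lra.
Qed.

End Uniqueness.

Lemma real_scale_exists (R : realType) (k : scalar_kind) :
  inhabited (real_scale R (scalar_field R k)).
Proof.
constructor; case: k => /=.
  by apply: (@RealScale R R idfun (fun _ _ => erefl) idfun).
apply: (@RealScale R R[i]%C (real_complex R) _ (@complex.Re R)).
  by move=> x y; rewrite lecR.
by move=> [a b]; rewrite lecE /= => /andP[/eqP -> _].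
Qed.

Theorem corollary3p4 (R : realType) (k : scalar_kind)
    (G V : completeNormedModType (scalar_field R k))
    (Omega : {linear G -> G}) (P : {linear V -> G})
    (hG : gurarii_space G)
    (hOmega_ne : nonexpansive Omega)
    (hOmega : gurarii_operator Omega)
    (hV : separable_space V)
    (hP_ne : nonexpansive P)
    (hP : left_gurarii_operator P) :
  exists (j : {linear V -> G}) (i : {linear G -> G}),
    [/\ bijective j /\ isometric j,
        bijective i /\ isometric i &
        Omega \o j =1 i \o P].
Proof.
have [S] := real_scale_exists R k; have sG := hG.1.
apply: (@extension_property_unique _ _ S) => //.
- exact: extension_of_left_gurarii.
- exact: extension_of_gurarii.
Qed.
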